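(* Let $(M,g)$ be a general relativistic perfect fluid spacetime with isotropic pressure $p$, energy-density $\sigma$, cosmological constant $\lambda$, gravitational constant $k$ and velocity vector field $\xi$ with $g$-dual $1$-form $\eta$, so that $g(\xi,\xi)=-1$ and $$S(X,Y)=-\left(\lambda-\frac{r}{2}-kp\right)g(X,Y)+k(\sigma+p)\eta(X)\eta(Y)$$ for all $X,Y\in\chi(M)$. Suppose that $\xi$ is torse-forming of the form $\nabla_X\xi=X+\eta(X)\xi$ for all $X\in\chi(M)$. Then: 1. If $(\xi,\cdot)_{S}\cdot R=0$, then $p=\frac{\lambda}{k}$. 2. If $(\xi,\cdot)_{S}\cdot \mathcal{P}=0$, then $p=\frac{\lambda}{k}$ or $p=\frac{4\lambda+k\sigma-12}{3k}$. 3. If $(\xi,\cdot)_{S}\cdot \mathcal{C}=0$, then $p=\frac{\lambda}{k}$ or $p=\frac{2\lambda-k\sigma-6}{3k}$. 4. If $(\xi,\cdot)_{S}\cdot \mathcal{H}=0$, then $p=\frac{\lambda}{k}$ or $p=\frac{\lambda-1}{k}$.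
   Context: A perfect fluid spacetime here is a connected $4$-dimensional smooth manifold $M$ with a Lorentzian metric $g$ (one negative sign in the signature), a smooth vector field $\xi$ with $g(\xi,\xi)=-1$, its dual $1$-form $\eta(X)=g(X,\xi)$, and smooth functions $p,\sigma$ on $M$ (not necessarily constant); $\lambda$ is a real constant and $k>0$ is a real constant (e.g. $k=8\pi G$). $\chi(M)$ is the set of smooth vector fields, $\nabla$ the Levi-Civita connection, $R(X,Y)Z=\nabla_X\nabla_YZ-\nabla_Y\nabla_XZ-\nabla_{[X,Y]}Z$ the Riemann curvature tensor, $S(Y,Z)=\mathrm{trace}(X\mapsto R(X,Y)Z)$ the Ricci tensor, $Q$ the Ricci operator, $g(QX,Y)=S(X,Y)$, and $r$ the scalar curvature. Equalities such as $p=\lambda/k$ are equalities of functions on $M$. The concircular, conformal and conharmonic curvature tensors ($\dim M=4$) are $$\mathcal{P}(X,Y)Z=R(X,Y)Z+\frac{r}{12}[g(Z,X)Y-g(Y,Z)X],$$ $$\mathcal{C}(X,Y)Z=R(X,Y)Z+\frac12\left\{-\frac{r}{3}[g(Z,X)Y-g(Y,Z)X]+g(Z,X)QY-g(Y,Z)QX+S(Z,X)Y-S(Y,Z)X\right\},$$ $$\mathcal{H}(X,Y)Z=R(X,Y)Z+\frac12[g(Z,X)QY-g(Y,Z)QX+S(Z,X)Y-S(Y,Z)X].$$ Put $(X\wedge_SY)Z:=S(Y,Z)X-S(X,Z)Y$. For a $(1,3)$-tensor field $\mathcal{T}$, the condition $(\xi,\cdot)_{S}\cdot\mathcal{T}=0$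 means that for all $X,Y,Z,W\in\chi(M)$ $$(\xi\wedge_SX)\mathcal{T}(Y,Z)W+\mathcal{T}((\xi\wedge_SX)Y,Z)W+\mathcal{T}(Y,(\xi\wedge_SX)Z)W+\mathcal{T}(Y,Z)(\xi\wedge_SX)W=0.$$ *)

(* Defs.v *)
From HB Require Import structures.
From mathcomp Require Import all_boot all_order all_algebra.
From mathcomp Require Import all_classical all_reals all_analysis.
Set Implicit Arguments.
Unset Strict Implicit.
Unset Printing Implicit Defensive.
Import Order.TTheory GRing.Theory Num.Theory.
Import numFieldNormedType.Exports.
Local Open Scope classical_set_scope.
Local Open Scope ring_scope.

(* U is meant to be open and V finite-dimensional: f is then C^n on U in the
   usual sense. Only the germs of f at the points of U matter, so partial maps
   may be extended arbitrarily outside U. *)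
Fixpoint Ck (R : realType) (V W : normedModType R) (n : nat) (U : set V)
    (f : V -> W) : Prop :=
  match n with
  | 0 => forall y, U y -> {for y, continuous f}
  | m.+1 => (forall y, U y -> differentiable f y) /\
            forall v, Ck m U (fun y => 'd f y v)
  end.

Definition smooth_on (R : realType) (V W : normedModType R) (U : set V)
  (f : V -> W) : Prop := forall n, Ck n U f.

Record chart (R : realType) (M : topologicalType) := Chart {
  dom : set M ;
  coord :> M -> 'rV[R]_4 ;
  coordV : 'rV[R]_4 -> M ;
  dom_open : open dom ;
  codom_open : open (coord @` dom) ;
  coordK : forall x, dom x -> coordV (coord x) = x ;
  coord_continuous : forall x, dom x -> {for x, continuous coord} ;
  coordV_continuous :
    forall y, (coord @` dom) y -> {for y, continuous coordV} }.

Definition codom_chart (R : realType) (M : topologicalType)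
  (phi : chart R M) : set 'rV[R]_4 := phi @` dom phi.

(* The tangent space at x is encoded as R^4 through the preferred chart
   chart_at x. *)
Record smooth_structure (R : realType) (M : topologicalType) :=
    SmoothStructure {
  atlas : set (chart R M) ;
  chart_at : M -> chart R M ;
  chart_at_atlas : forall x, atlas (chart_at x) ;
  mem_chart_at : forall x, dom (chart_at x) x ;
  smooth_transition : forall phi psi, atlas phi -> atlas psi ->
    smooth_on (phi @` (dom phi `&` dom psi)) (fun y => psi (coordV phi y)) }.

Section Fields.
Context {R : realType} {M : topologicalType}.
Variable A : smooth_structure R M.

Definition smooth_fun (f : M -> R) : Prop :=
  forall phi, atlas A phi ->
    smooth_on (codom_chart phi) (fun y => f (coordV phi y) : R^o).

(* Components in the chart phi, at the point of coordinates y, of a vector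
   field X (whose value X x is expressed in the preferred chart at x). *)
Definition vf_in (phi : chart R M) (X : M -> 'rV[R]_4) (y : 'rV[R]_4) :
    'rV[R]_4 :=
  let x := coordV phi y in
  'd (fun z => phi (coordV (chart_at A x) z)) (chart_at A x x) (X x).

Definition smooth_vf (X : M -> 'rV[R]_4) : Prop :=
  forall phi, atlas A phi -> smooth_on (codom_chart phi) (vf_in phi X).

Definition scale_vf (f : M -> R) (X : M -> 'rV[R]_4) : M -> 'rV[R]_4 :=
  fun x => f x *: X x.

Definition vf_deriv (X : M -> 'rV[R]_4) (f : M -> R) : M -> R := fun x =>
  'd (fun z => f (coordV (chart_at A x) z) : R^o) (chart_at A x x) (X x).

(* [X, Y]^i = X^j d_j Y^i - Y^j d_j X^i, in the preferred chart at x. *)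
Definition bracket (X Y : M -> 'rV[R]_4) : M -> 'rV[R]_4 := fun x =>
  let phi := chart_at A x in
  'd (vf_in phi Y) (phi x) (X x) - 'd (vf_in phi X) (phi x) (Y x).

(* Such an X exists on every Hausdorff manifold (bump functions), in which case
   the default value of xget plays no role. *)
Definition extend (x : M) (v : 'rV[R]_4) : M -> 'rV[R]_4 :=
  xget (fun=> 0) [set X | smooth_vf X /\ X x = v].

(* Pointwise trace of a C^oo(M)-linear endomorphism F of the vector fields:
   row i is the image of the i-th basis vector of the tangent space at x under
   the endomorphism induced by F, which by C^oo(M)-linearity does not depend
   on the extension of that vector. *)
Definition trace_vf (F : (M -> 'rV[R]_4) -> (M -> 'rV[R]_4)) : M -> R :=
  fun x => \tr (\matrix_(i < 4) F (extend x (delta_mx 0 i)) x).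

Definition metric_app (G : M -> 'M[R]_4) (X Y : M -> 'rV[R]_4) : M -> R :=
  fun x => (X x *m G x *m (Y x)^T) 0 0.

Definition minkowski : 'M[R]_4 :=
  diag_mx (\row_(i < 4) if i == ord0 then -1 else 1).

Record lorentz_metric := LorentzMetric {
  gram : M -> 'M[R]_4 ;
  gram_sym : forall x, (gram x)^T = gram x ;
  gram_signature : forall x, exists2 P : 'M[R]_4,
    P \in unitmx & P *m gram x *m P^T = minkowski ;
  gram_smooth : forall X Y, smooth_vf X -> smooth_vf Y ->
    smooth_fun (metric_app gram X Y) }.

Definition gmetric (g : lorentz_metric) : (M -> 'rV[R]_4) ->
  (M -> 'rV[R]_4) -> M -> R := metric_app (gram g).

(* Only the values of nabla on smooth vector fields are constrained. *)
Record levi_civita (g : lorentz_metric)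
    (nabla : (M -> 'rV[R]_4) -> (M -> 'rV[R]_4) -> M -> 'rV[R]_4) : Prop :=
    LeviCivita {
  nabla_smooth : forall X Y, smooth_vf X -> smooth_vf Y ->
    smooth_vf (nabla X Y) ;
  nablaDl : forall X Y Z, smooth_vf X -> smooth_vf Y -> smooth_vf Z ->
    nabla (X \+ Y) Z = nabla X Z \+ nabla Y Z ;
  nablaZl : forall f X Y, smooth_fun f -> smooth_vf X -> smooth_vf Y ->
    nabla (scale_vf f X) Y = scale_vf f (nabla X Y) ;
  nablaDr : forall X Y Z, smooth_vf X -> smooth_vf Y -> smooth_vf Z ->
    nabla X (Y \+ Z) = nabla X Y \+ nabla X Z ;
  nabla_leibniz : forall f X Y, smooth_fun f -> smooth_vf X -> smooth_vf Y ->
    nabla X (scale_vf f Y) = scale_vf (vf_deriv X f) Y \+ scale_vf f (nabla X Y) ;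
  nabla_torsion_free : forall X Y, smooth_vf X -> smooth_vf Y ->
    nabla X Y \- nabla Y X = bracket X Y ;
  nabla_metric : forall X Y Z, smooth_vf X -> smooth_vf Y -> smooth_vf Z ->
    vf_deriv X (gmetric g Y Z) =
      gmetric g (nabla X Y) Z \+ gmetric g Y (nabla X Z) }.

Variables (g : lorentz_metric)
  (nabla : (M -> 'rV[R]_4) -> (M -> 'rV[R]_4) -> M -> 'rV[R]_4).

Definition riemann (X Y Z : M -> 'rV[R]_4) : M -> 'rV[R]_4 :=
  nabla X (nabla Y Z) \- nabla Y (nabla X Z) \- nabla (bracket X Y) Z.

Definition ricci (Y Z : M -> 'rV[R]_4) : M -> R :=
  trace_vf (fun X => riemann X Y Z).

(* Solution of g(QX, e_j) = S(X, e_j) at x, for the basis e_j of the tangent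
   space. *)
Definition ricci_op (X : M -> 'rV[R]_4) : M -> 'rV[R]_4 := fun x =>
  (\row_(j < 4) ricci X (extend x (delta_mx 0 j)) x) *m invmx (gram g x).

Definition scalar_curvature : M -> R := trace_vf ricci_op.

Definition concircular (X Y Z : M -> 'rV[R]_4) : M -> 'rV[R]_4 := fun x =>
  riemann X Y Z x + (scalar_curvature x / 12) *:
    (gmetric g Z X x *: Y x - gmetric g Y Z x *: X x).

Definition conformal (X Y Z : M -> 'rV[R]_4) : M -> 'rV[R]_4 := fun x =>
  riemann X Y Z x + 2^-1 *:
    (- (scalar_curvature x / 3) *:
       (gmetric g Z X x *: Y x - gmetric g Y Z x *: X x)
     + gmetric g Z X x *: ricci_op Y x - gmetric g Y Z x *: ricci_op X x
     + ricci Z X x *: Y x - ricci Y Z x *: X x).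

Definition conharmonic (X Y Z : M -> 'rV[R]_4) : M -> 'rV[R]_4 := fun x =>
  riemann X Y Z x + 2^-1 *:
    (gmetric g Z X x *: ricci_op Y x - gmetric g Y Z x *: ricci_op X x
     + ricci Z X x *: Y x - ricci Y Z x *: X x).

Definition wedge_ricci (X Y Z : M -> 'rV[R]_4) : M -> 'rV[R]_4 :=
  scale_vf (ricci Y Z) X \- scale_vf (ricci X Z) Y.

(* (xi, .)_S . T = 0 *)
Definition ricci_wedge_annihilates (xi : M -> 'rV[R]_4)
    (T : (M -> 'rV[R]_4) -> (M -> 'rV[R]_4) -> (M -> 'rV[R]_4) ->
         M -> 'rV[R]_4) : Prop :=
  forall X Y Z W,
    smooth_vf X -> smooth_vf Y -> smooth_vf Z -> smooth_vf W ->
    forall x,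
      wedge_ricci xi X (T Y Z W) x + T (wedge_ricci xi X Y) Z W x
      + T Y (wedge_ricci xi X Z) W x + T Y Z (wedge_ricci xi X W) x = 0.

Definition dual_form (xi X : M -> 'rV[R]_4) : M -> R := gmetric g X xi.

Definition perfect_fluid (lam k : R) (p sigma : M -> R)
    (xi : M -> 'rV[R]_4) : Prop :=
  forall X Y, smooth_vf X -> smooth_vf Y -> forall x,
    ricci X Y x =
      - (lam - scalar_curvature x / 2 - k * p x) * gmetric g X Y x
      + k * (sigma x + p x) * dual_form xi X x * dual_form xi Y x.

Definition torse_forming (xi : M -> 'rV[R]_4) : Prop :=
  forall X, smooth_vf X -> nabla X xi = X \+ scale_vf (dual_form xi X) xi.

End Fields.

(* Main.v *)
From HB Require Import structures.
Require Import Defs.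
From mathcomp Require Import all_boot all_order all_algebra.
From mathcomp Require Import all_classical all_reals all_analysis.
From mathcomp Require Import ring lra.
Import Order.TTheory GRing.Theory Num.Theory.
Import numFieldNormedType.Exports.
Local Open Scope classical_set_scope.
Local Open Scope ring_scope.

(* The torse-forming equation gives R(X,Y)xi = eta(Y)X - eta(X)Y, hence
   S(Y,xi) = 3 eta(Y); traces are taken over smooth extensions of the basis
   vectors, which exist by means of bump functions. Comparing with
   the fluid equation, S = a g + (a - 3) eta (x) eta with a = 2 lam - 3 - 2 k p,
   r = 3 a + 3 and k sigma = 2 lam - 3 k p - 6; the last equality is the second
   alternative of item 3, which therefore always holds.
   For T = R, P or H there is a function c (equal to 1, (3 - a) / 4 and
   - (a + 1) / 2 respectively) such that T(Y,Z)xi = c (eta(Z)Y - eta(Y)Z) and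
   eta(T(Y,xi)V) = c g(V,Y) whenever eta(V) = 0. Taking Z = W = xi and X
   orthogonal to xi in the curvature condition and pairing with xi yields
   c (a + 3) g(X,Y) = 0, i.e. c = 0 or p = lam / k at each point; as p is
   continuous and takes at most two values, connectedness of M makes the
   alternative global. *)

Set Implicit Arguments.
Unset Strict Implicit.

(** * Calculus of C^n maps *)

Section Differential.
Context {R : realType}.
Implicit Types V W Z : normedModType R.

(** Only the germ matters: the little-o expansion of [f] at [x] holds for [g], and uniqueness of the
    linear part identifies the differentials. *)
Lemma near_eq_is_diff V W (f g : V -> W) x :
  (\near x, f x = g x) -> differentiable f x -> is_diff x g ('d f x).
Proof.
move=> fg df.
have gE : g \o shift x = cst (g x) + 'd f x +o_ 0 id.
  apply/eqaddoP => e e0.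
  have fgx : f x = g x by exact: nbhs_singleton fg.
  have /eqaddoP/(_ e e0) dfe := diff_locally df.
  have fg0 : \forall h \near 0, f (h + x) = g (h + x).
    by have := fg; rewrite (near_shift 0) /=; apply: filterS => y; rewrite /= subr0.
  apply: filterS2 fg0 dfe => h /= fgh.
  by rewrite !fctE /= -fgx -fgh.
have gd : 'd g x = 'd f x :> (V -> W).
  exact: (diff_unique (diff_continuous df) gE).
apply: DiffDef => //; apply/diff_locallyP; rewrite gd; split => //.
exact: diff_continuous.
Qed.

Lemma scale_is_bilinear W :
  bilinear_for
    (GRing.Scale.Law.clone _ _ *:%R _) (GRing.Scale.Law.clone _ _ *:%R _)
    (@GRing.scale R W).
Proof.
split=> [u a x y|u a x y] /=; first by rewrite scalerDl scalerA.
by rewrite scalerDr !scalerA mulrC.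
Qed.
HB.instance Definition _ W := bilinear_isBilinear.Build R R W W _ _
  (@GRing.scale R W) (scale_is_bilinear W).

(** Product rule, obtained by composing [y |-> (c y, f y)] with the bilinear map [*:%R]. *)
Lemma is_diff_scale V W (c dc : V -> R^o) (f df : V -> W) x :
  is_diff x c dc -> is_diff x f df ->
  is_diff x (fun y => c y *: f y) (fun v => c x *: df v + dc v *: f x).
Proof.
move=> hc hf.
have sc : continuous (fun q : R^o * W => q.1 *: q.2).
  exact: scale_continuous.
have hs : is_diff (c x, f x) (fun q : R^o * W => q.1 *: q.2)
    (fun q => c x *: q.2 + q.1 *: f x).
  apply: DiffDef; first exact: (@differentiable_bilin R R^o W W).
  exact: (@diff_bilin R R^o W W).
exact: (@is_diff_comp _ _ _ _ _ _ _ _ _ (is_diff_pair hc hf) hs).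
Qed.

End Differential.

Section Ck_calculus.
Context {R : realType}.
Implicit Types V W Z : normedModType R.

Lemma Ck_differentiable V W n (U : set V) (f : V -> W) y :
  Ck n.+1 U f -> U y -> differentiable f y.
Proof. by case=> + _; apply. Qed.

Lemma CkW V W n (U : set V) (f : V -> W) : Ck n.+1 U f -> Ck n U f.
Proof.
elim: n f => [f [df _] y Uy|n IH f [df Cf]].
  exact/differentiable_continuous/df.
by split=> // v; exact/IH/Cf.
Qed.

(** Since the differential depends only on the germ, the local models [f'] also compute the
    derivatives of [f]. This permits gluing fields given by different formulas on different open
    sets. *)
Lemma Ck_local V W n (U : set V) (f : V -> W) :
  (forall y, U y -> exists (N : set V) (f' : V -> W),
    [/\ open N, N y, Ck n N f' & forall z, N z -> f z = f' z]) -> Ck n U f.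
Proof.
elim: n f => [f|n IH f] H.
  move=> y /H [N [f' [oN Ny Cf' ff']]].
  have nN : nbhs y N by exact: open_nbhs_nbhs.
  rewrite /prop_for /continuous_at ff'//; apply: cvg_trans (Cf' _ Ny).
  by apply: near_eq_cvg; apply: filterS nN => z /ff'.
have dE y N f' : open N -> (forall z, N z -> f z = f' z) -> Ck n.+1 N f' ->
    N y -> is_diff y f ('d f' y).
  move=> oN ff' Cf' Ny; apply: near_eq_is_diff; last exact: Ck_differentiable Cf' Ny.
  by have := open_nbhs_nbhs (conj oN Ny); apply: filterS => z Nz; rewrite ff'.
split=> [y /H[N [f' [oN Ny Cf' ff']]]|v].
  by have [] := dE _ _ _ oN ff' Cf' Ny.
apply: IH => y /H[N [f' [oN Ny Cf' ff']]].
exists N, (fun y => 'd f' y v); split=> //; first by case: Cf' => _; apply.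
by move=> z Nz; have [_ ->] := dE _ _ _ oN ff' Cf' Nz.
Qed.

Lemma Ck_ext V W n (U : set V) (f g : V -> W) :
  open U -> (forall y, U y -> f y = g y) -> Ck n U g -> Ck n U f.
Proof. by move=> oU fg Cg; apply: Ck_local => y Uy; exists U, g. Qed.

Lemma Ck_cst V W n (U : set V) (a : W) : Ck n U (cst a : V -> W).
Proof.
elim: n a => [a y _|n IH a]; first exact: cst_continuous.
split=> [y _|v]; first exact: differentiable_cst.
by rewrite [X in Ck _ _ X](_ : _ = cst 0); [exact: IH|apply/funext=> y; rewrite diff_cst].
Qed.

Lemma CkD V W n (U : set V) (f g : V -> W) : open U ->
  Ck n U f -> Ck n U g -> Ck n U (fun y => f y + g y).
Proof.
move=> oU; elim: n f g => [f g Cf Cg y Uy|n IH f g [df Cf] [dg Cg]].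
  exact: cvgD (Cf _ Uy) (Cg _ Uy).
split=> [y Uy|v]; first exact: differentiableD (df _ Uy) (dg _ Uy).
apply: Ck_ext oU _ (IH _ _ (Cf v) (Cg v)) => y Uy.
by rewrite (diffD (df _ Uy) (dg _ Uy)).
Qed.

Lemma CkZ V W n (U : set V) (c : V -> R^o) (f : V -> W) : open U ->
  Ck n U c -> Ck n U f -> Ck n U (fun y => c y *: f y).
Proof.
move=> oU; elim: n c f => [c f Cc Cf y Uy|n IH c f Cc Cf].
  exact: cvgZ (Cc _ Uy) (Cf _ Uy).
have [[dc Cdc] [df Cdf]] := (Cc, Cf).
have dE y : U y ->
    is_diff y (fun y => c y *: f y) (fun v => c y *: 'd f y v + 'd c y v *: f y).
  by move=> Uy; apply: is_diff_scale; apply: differentiableP; [exact: dc|exact: df].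
split=> [y /dE[]//|v].
apply: Ck_ext oU _ (CkD oU (IH _ _ (CkW Cc) (Cdf v)) (IH _ _ (Cdc v) (CkW Cf))) => y Uy.
by have [_ ->] := dE _ Uy.
Qed.

Lemma Ck_sum V W n (U : set V) (I : Type) (r : seq I) (f : I -> V -> W) :
  open U -> (forall i, Ck n U (f i)) -> Ck n U (fun y => \sum_(i <- r) f i y).
Proof.
move=> oU Cf; elim: r => [|i r IH].
  by under eq_fun do rewrite big_nil; exact: Ck_cst.
by under eq_fun do rewrite big_cons; exact: CkD.
Qed.

Lemma Ck_linear V W Z n (U : set V) (L : {linear W -> Z}) (f : V -> W) :
  open U -> continuous L -> Ck n U f -> Ck n U (L \o f).
Proof.
move=> oU cL; elim: n f => [f Cf y Uy|n IH f [df Cf]].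
  exact: continuous_comp (Cf _ Uy) (cL _).
have dL z : differentiable L z by exact: linear_differentiable.
split=> [y Uy|v]; first exact: differentiable_comp (df _ Uy) (dL _).
apply: Ck_ext oU _ (IH _ (Cf v)) => y Uy.
by rewrite (diff_comp (df _ Uy) (dL _)) /= diff_lin.
Qed.

Definition row_coord m (i : 'I_m) (A : 'rV[R]_m) : R^o := A 0 i.

Lemma row_coord_linear m (i : 'I_m) : linear (row_coord i).
Proof. by move=> a u v; rewrite /row_coord !mxE. Qed.
HB.instance Definition _ m (i : 'I_m) := GRing.isLinear.Build _ _ _ _ _
  (row_coord_linear i).

Lemma Ck_coord V m n (U : set V) (f : V -> 'rV[R]_m) (i : 'I_m) :
  open U -> Ck n U f -> Ck n U (row_coord i \o f).
Proof. by move=> oU Cf; apply: Ck_linear => //; exact: coord_continuous. Qed.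

(** The chain rule produces ['d g (f y) ('d f y v)], whose direction varies with [y]. Expanding that
    direction in the standard basis gives a finite sum of products with fixed directions, to which
    [CkZ] and the induction hypothesis apply. *)
Lemma Ck_comp V W m n (U : set V) (U' : set 'rV[R]_m)
    (f : V -> 'rV[R]_m) (g : 'rV[R]_m -> W) :
  open U -> (forall y, U y -> U' (f y)) ->
  Ck n U f -> Ck n U' g -> Ck n U (g \o f).
Proof.
move=> oU fU; elim: n f g fU => [f g fU Cf Cg y Uy|n IH f g fU Cf Cg].
  exact: continuous_comp (Cf _ Uy) (Cg _ (fU _ Uy)).
have [[df Cdf] [dg Cdg]] := (Cf, Cg).
split=> [y Uy|v]; first exact: differentiable_comp (df _ Uy) (dg _ (fU _ Uy)).
refine (@Ck_ext _ _ _ _ _ (fun y => \sum_(i < m)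
  row_coord i ('d f y v) *: 'd g (f y) (delta_mx 0 i)) oU _ _).
  move=> y Uy; rewrite (diff_comp (df _ Uy) (dg _ (fU _ Uy))) /=.
  rewrite {1}['d f y v]row_sum_delta linear_sum; apply: eq_bigr => i _.
  by rewrite linearZ.
apply: Ck_sum => // i; apply: CkZ => //.
  exact: (@Ck_coord _ _ _ _ (fun y => 'd f y v) i oU (Cdf v)).
exact: (IH _ (fun y => 'd g y (delta_mx 0 i)) fU (CkW Cf) (Cdg _)).
Qed.

End Ck_calculus.

(** * Bump functions *)

Section Flat.
Context {R : realType}.

(* Indexing by n makes the family closed under derivation up to linear
   combinations; at 0 the derivative vanishes by the quadratic bound flat_le. *)
Definition flat n (t : R^o) : R^o :=
  if 0 < t then t^-1 ^+ n * expR (- t^-1) else 0.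

(** For [s = t^-1 > 0], the exponential series gives [s ^+ n.+2 / (n.+2)! <= expR s]; dividing by
    [s ^+ 2 * expR s] yields the bound. *)
Lemma flat_le n t : `|flat n t| <= (n.+2)`!%:R * t ^+ 2.
Proof.
rewrite /flat; case: ifPn => [t0|_]; last first.
  by rewrite normr0 mulr_ge0 // sqr_ge0.
have s0 : 0 < t^-1 by rewrite invr_gt0.
have F0 : 0 < (n.+2)`!%:R :> R by rewrite ltr0n fact_gt0.
rewrite ger0_norm; last by rewrite mulr_ge0 ?expR_ge0 // exprn_ge0 // ltW.
rewrite expRN ler_pdivrMr ?expR_gt0 //.
have := expR_ge1Dxn n.+1 (ltW s0).
have -> : t^-1 ^+ n = (n.+2)`!%:R * t ^+ 2 * (t^-1 ^+ n.+2 / (n.+2)`!%:R).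
  rewrite !exprS; field; rewrite ?gt_eqF //.
move=> h; rewrite ler_pM2l ?mulr_gt0 ?exprn_gt0 //.
by apply: le_trans h; rewrite lerDr.
Qed.

Lemma is_diff_flat n t :
  is_diff t (flat n) (fun v => v *: (flat n.+2 t - n%:R * flat n.+1 t)).
Proof.
case: (ltrgt0P t) => t0.
- have tn0 : t != 0 by rewrite gt_eqF.
  have /near_eq_is_diff : \near t, t^-1 ^+ n * expR (- t^-1) = flat n t.
    have : nbhs t [set x | 0 < x] by exact: lt_nbhsr.
    by apply: filterS => x /= x0; rewrite /flat x0.
  have dV : is_derive t 1 (fun t : R => t^-1) (- t ^- 2).
    by apply: is_derive_eq; first exact: is_deriveV; rewrite [RHS]/= -[RHS]mulr1.
  have dE : is_derive t 1 (fun t : R => expR (- t^-1)) (expR (- t^-1) * t ^- 2).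
    by rewrite -[t ^- 2]opprK; apply: (@is_derive1_comp _ expR (fun t => - t^-1)).
  have dX : is_derive t 1 (fun t : R => t^-1 ^+ n) (n%:R * t^-1 ^+ n.-1 * - t ^- 2).
    by have := (@is_deriveX _ _ (fun t : R => t^-1) n t 1 _ dV); rewrite exprfctE.
  have := is_deriveM dX dE => -[dXE vXE].
  have df : differentiable (fun t : R^o => t^-1 ^+ n * expR (- t^-1) : R^o) t.
    exact/derivable1_diffP.
  move=> /(_ df) fE; apply: (is_diff_eq fE).
  rewrite diff1E // derive1E vXE; apply/funext => v; congr (_ *: _).
  rewrite /flat t0 /=; case: n {df dX dXE vXE fE} => [|m] /=;
    rewrite /GRing.scale /= !exprS; by field; rewrite tn0.
- have : \near t, cst 0 t = flat n t.
    have : nbhs t [set x | x < 0] by exact: lt_nbhsl.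
    by apply: filterS => x /= x0; rewrite /flat ltNge ltW.
  move=> /near_eq_is_diff /(_ (differentiable_cst _ _)) fE.
  apply: (is_diff_eq fE); rewrite diff_cst /flat ltNge ltW //=.
  by apply/funext => v; rewrite mulr0 subr0 scaler0.
- have h0 : flat n 0 = 0 by rewrite /flat ltxx.
  pose z : {linear R^o -> R^o} := \0.
  have zc : continuous z by exact: cst_continuous.
  have h : flat n \o shift 0 = cst (flat n 0) + z +o_ 0 id.
    apply/eqaddoP => e e0.
    have F0 : 0 < (n.+2)`!%:R :> R by rewrite ltr0n fact_gt0.
    (* Within this radius the quadratic bound of [flat_le] is at most [e * |u|], so the zero map is
       the linear part at 0. *)
    have e1 : 0 < (n.+2)`!%:R^-1 * e by rewrite mulr_gt0 // invr_gt0.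
    apply: filterS (nbhs0_le (V := R^o) e1) => u ue.
    rewrite !fctE /= h0 !addr0 subr0; apply: le_trans (flat_le n u) _.
    rewrite -real_normK ?num_real // expr2 mulrA ler_wpM2r //.
    by rewrite -ler_pdivlMl.
  have dz := diff_unique zc h.
  apply: DiffDef; first by apply/diff_locallyP; rewrite t0 dz; split.
  rewrite t0 dz; apply/funext => v.
  by rewrite /flat ltxx mulr0 subr0 scaler0.
Qed.

Lemma Ck_flat (V : normedModType R) k n (U : set V) (f : V -> R^o) :
  open U -> Ck k U f -> Ck k U (flat n \o f).
Proof.
move=> oU; elim: k n f => [n f Cf y Uy|k IH n f Cf].
  apply: continuous_comp (Cf _ Uy) _; apply: differentiable_continuous.
  by have [] := is_diff_flat n (f y).
have [df Cdf] := Cf.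
have dE y : U y -> is_diff y (flat n \o f)
    (fun v => 'd f y v *: (flat n.+2 (f y) - n%:R * flat n.+1 (f y))).
  move=> Uy; exact: (is_diff_comp (differentiableP (df _ Uy)) (is_diff_flat n (f y))).
split=> [y /dE[]//|v].
apply: (Ck_ext (g := fun y => 'd f y v *:
  (flat n.+2 (f y) + (- n%:R : R^o) *: flat n.+1 (f y) : R^o)) oU).
  by move=> y Uy; have [_ ->] := dE _ Uy; rewrite scaleNr.
apply: CkZ (Cdf v) _ => //.
have C m : Ck k U (flat m \o f) := IH m f (CkW Cf).
exact: (CkD oU (C n.+2) (CkZ (c := cst (- n%:R : R^o)) oU (Ck_cst _ _ _) (C n.+1))).
Qed.

End Flat.

Section Cube_bump.
Context {R : realType}.

Lemma Ck_id (V : normedModType R) n (U : set V) : Ck n U (@id V).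
Proof.
case: n => [y _|n]; first exact: cvg_id.
split=> [//|v].
rewrite [X in Ck _ _ X](_ : _ = cst v); first exact: Ck_cst.
by apply/funext => y; rewrite diff_val.
Qed.

Lemma Ck_prod (V : normedModType R) n (U : set V) (I : Type) (r : seq I)
    (f : I -> V -> R^o) :
  open U -> (forall i, Ck n U (f i)) -> Ck n U (fun y => \prod_(i <- r) f i y : R^o).
Proof.
move=> oU Cf; elim: r => [|i r IH].
  by under eq_fun do rewrite big_nil; exact: Ck_cst.
by under eq_fun do rewrite big_cons; exact: (CkZ oU (Cf i) IH).
Qed.

(** Both arguments of [flat 0] in a factor are positive exactly when [|y_i - y0_i| < e]. The support
    is thus a cube, which suits the sup norm on row vectors. *)
Definition cube_bump m (y0 : 'rV[R]_m) (e : R) (y : 'rV[R]_m) : R^o :=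
  \prod_(i < m) (flat 0 (e - (y 0 i - y0 0 i)) * flat 0 (e + (y 0 i - y0 0 i))).

Lemma flat0_gt0 (t : R) : (0 < flat 0 t) = (0 < t).
Proof.
rewrite /flat; case: ifP => t0; last by rewrite ltxx.
by rewrite mul1r expR_gt0.
Qed.

Lemma Ck_cube_bump m (y0 : 'rV[R]_m) e n (U : set 'rV[R]_m) :
  open U -> Ck n U (cube_bump y0 e).
Proof.
move=> oU; apply: Ck_prod => // i.
have Ci : Ck n U (row_coord i) := Ck_coord i oU (Ck_id n U).
have Cc c : Ck n U (cst c : 'rV[R]_m -> R^o) by exact: Ck_cst.
apply: (CkZ oU); rewrite -/(flat 0 \o _); apply: Ck_flat => //.
  apply: (Ck_ext (g := fun y => (e + y0 0 i : R^o) + (-1 : R^o) *: row_coord i y)) => //.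
    by move=> y _; rewrite /row_coord scaleN1r; lra.
  exact: (CkD oU (Cc _) (CkZ oU (Cc _) Ci)).
apply: (Ck_ext (g := fun y => (e - y0 0 i : R^o) + row_coord i y)) => //.
  by move=> y _; rewrite /row_coord; lra.
exact: (CkD oU (Cc _) Ci).
Qed.

Lemma cube_bump_center m (y0 : 'rV[R]_m) e : 0 < e -> 0 < cube_bump y0 e y0.
Proof.
move=> e0; apply: prodr_gt0 => i _.
by rewrite subrr subr0 addr0 mulr_gt0 // flat0_gt0.
Qed.

Lemma cube_bump_out m (y0 y : 'rV[R]_m) e i :
  e <= `|y 0 i - y0 0 i| -> cube_bump y0 e y = 0.
Proof.
move=> ye; rewrite /cube_bump (bigD1 i) //=.
move: ye; rewrite leNgt ltr_norml => ye.
rewrite {1 2}/flat; case: ifP => [h1|]; last by rewrite !mul0r.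
by case: ifP => [h2|]; [move: ye h1 h2; lra|rewrite mulr0 mul0r].
Qed.

End Cube_bump.

(** * Charts and smooth vector fields *)

Section Manifold.
Context {R : realType} {M : topologicalType}.
Implicit Types phi psi chi : chart R M.

Lemma codom_coord phi x : dom phi x -> codom_chart phi (phi x).
Proof. by move=> dx; exists x. Qed.

Lemma dom_coordV phi y : codom_chart phi y -> dom phi (coordV phi y).
Proof. by case=> x dx <-; rewrite coordK. Qed.

Lemma coordVK phi y : codom_chart phi y -> phi (coordV phi y) = y.
Proof. by case=> x dx <-; rewrite coordK. Qed.

Lemma open_coordV_preimage phi (N : set M) : open N ->
  open [set y | codom_chart phi y /\ N (coordV phi y)].
Proof.
move=> oN; rewrite openE => y [cy Ny].
have h1 : nbhs y (codom_chart phi) by apply: open_nbhs_nbhs; split=> //; exact: codom_open.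
have h2 := coordV_continuous cy (open_nbhs_nbhs (conj oN Ny)).
exact: filterI h1 h2.
Qed.

Lemma overlapE phi psi : phi @` (dom phi `&` dom psi) =
  [set y | codom_chart phi y /\ dom psi (coordV phi y)].
Proof.
apply/seteqP; split=> y.
  by move=> [x [dx dx'] <-]; rewrite /= coordK //; split=> //; exact: codom_coord.
by move=> [cy dy]; exists (coordV phi y); [split=> //; exact: dom_coordV|exact: coordVK].
Qed.

Lemma open_overlap phi psi : open (phi @` (dom phi `&` dom psi)).
Proof. by rewrite overlapE; apply/open_coordV_preimage/dom_open. Qed.

Lemma overlap_coord phi psi x : dom phi x -> dom psi x ->
  (phi @` (dom phi `&` dom psi)) (phi x).
Proof. by move=> dx dx'; exists x. Qed.

Variable A : smooth_structure R M.

Lemma transition_differentiable phi psi x : atlas A phi -> atlas A psi ->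
  dom phi x -> dom psi x ->
  differentiable (fun y => psi (coordV phi y)) (phi x).
Proof.
move=> Aphi Apsi dx dx'.
exact: Ck_differentiable (smooth_transition Aphi Apsi 1%N) (overlap_coord dx dx').
Qed.

(** Chain rule for [psi \o coordV chi \o chi \o coordV phi], which agrees with the direct transition
    near [phi x]. It makes components independent of the preferred chart in which a vector is
    stored. *)
Lemma transition_comp phi chi psi x v :
  atlas A phi -> atlas A chi -> atlas A psi ->
  dom phi x -> dom chi x -> dom psi x ->
  'd (fun y => psi (coordV chi y)) (chi x)
    ('d (fun y => chi (coordV phi y)) (phi x) v) =
  'd (fun y => psi (coordV phi y)) (phi x) v.
Proof.
move=> Aphi Achi Apsi d1 d2 d3.
have e1 : (fun y => chi (coordV phi y)) (phi x) = chi x by rewrite /= coordK.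
have df := transition_differentiable Aphi Achi d1 d2.
have dg : differentiable (fun y => psi (coordV chi y)) ((fun y => chi (coordV phi y)) (phi x)).
  by rewrite e1; exact: transition_differentiable.
have := diff_comp df dg; rewrite e1 => dE.
have := @near_eq_is_diff _ _ _ ((fun y => psi (coordV chi y)) \o
  (fun y => chi (coordV phi y))) (fun y => psi (coordV phi y)) (phi x).
case.
- have := open_nbhs_nbhs (conj (@open_overlap phi chi) (overlap_coord d1 d2)).
  by apply: filterS => _ [z [d4 d5] <-] /=; rewrite (coordK d4) (coordK d5).
- exact: differentiable_comp.
- move=> _ E; exact: (esym (etrans (congr1 (@^~ v) E) (congr1 (@^~ v) dE))).
Qed.

Lemma transition_id phi x v : dom phi x ->
  'd (fun y => phi (coordV phi y)) (phi x) v = v.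
Proof.
move=> dx.
have := @near_eq_is_diff _ _ _ id (fun y => phi (coordV phi y)) (phi x).
case.
- have := open_nbhs_nbhs (conj (@codom_open _ _ phi) (codom_coord dx)).
  by apply: filterS => _ [z d4 <-] /=; rewrite (coordK d4).
- exact: ex_diff.
- by move=> _ ->; rewrite diff_val.
Qed.

(** The field with components [b * v] in the chart [phi], extended by zero; the differential
    converts [v] to the preferred chart at [x]. *)
Definition chart_vf phi (b : 'rV[R]_4 -> R^o) (v : 'rV[R]_4) (x : M) : 'rV[R]_4 :=
  if `[< dom phi x >] then
    b (phi x) *: 'd (fun y => chart_at A x (coordV phi y)) (phi x) v
  else 0.

Lemma vf_in_chart_vf phi b v psi y : atlas A phi -> atlas A psi ->
  codom_chart psi y -> dom phi (coordV psi y) ->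
  vf_in A psi (chart_vf phi b v) y =
  b (phi (coordV psi y)) *:
    'd (fun z => psi (coordV phi z)) (phi (coordV psi y)) v.
Proof.
move=> Aphi Apsi cy dy; rewrite /vf_in /chart_vf.
rewrite asboolT //.
rewrite [LHS]linearZ.
congr (_ *: _).
apply: transition_comp => //.
- exact: chart_at_atlas.
- exact: mem_chart_at.
- exact: dom_coordV.
Qed.

Lemma smooth_chart_vf phi b v (K : set M) : atlas A phi ->
  closed K -> K `<=` dom phi ->
  (forall x, dom phi x -> ~ K x -> b (phi x) = 0) ->
  smooth_on (codom_chart phi) b -> smooth_vf A (chart_vf phi b v).
Proof.
move=> Aphi cK Kphi b0 Cb psi Apsi n; apply: Ck_local => y cy.
have [Ky|nKy] := pselect (K (coordV psi y)).
  pose N := psi @` (dom psi `&` dom phi).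
  pose tau z := phi (coordV psi z).
  exists N, (fun z => b (tau z) *: 'd (fun z => psi (coordV phi z)) (tau z) v).
  have oN : open N by exact: open_overlap.
  have Ctau : Ck n N tau by exact: (smooth_transition Apsi Aphi n).
  split=> //.
  - by rewrite /N overlapE; split => //; exact: Kphi.
  - apply: CkZ => //.
      apply: (Ck_comp (f := tau) oN _ Ctau (Cb n)).
      by move=> _ [x [dx dx'] <-]; rewrite /tau coordK //; exact: codom_coord.
    (* The components contain a differential of the transition map, hence the order [n.+1]. *)
    have [_ Cd] := smooth_transition Aphi Apsi n.+1.
    apply: (Ck_comp (f := tau) oN _ Ctau (Cd v)).
    by move=> _ [x [dx dx'] <-]; rewrite /tau coordK //; exact: overlap_coord.
  - by move=> z; rewrite /N overlapE => -[cz dz]; exact: vf_in_chart_vf.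
exists [set z | codom_chart psi z /\ (~` K) (coordV psi z)], (cst 0); split=> //.
- by apply: open_coordV_preimage; rewrite openC.
- exact: Ck_cst.
- move=> z [cz nKz]; have [dz|ndz] := pselect (dom phi (coordV psi z)).
    by rewrite vf_in_chart_vf // b0 // scale0r.
  by rewrite /vf_in /chart_vf asboolF // linear0.
Qed.

(** A bump supported in a closed cube of the chart codomain cuts off a constant field. The image [K]
    of the cube is compact, and the Hausdorff hypothesis makes it closed in [M]. *)
Lemma exists_smooth_vf (x : M) (v : 'rV[R]_4) : hausdorff_space M ->
  exists X, smooth_vf A X /\ X x = v.
Proof.
move=> hM; pose phi := chart_at A x.
have Aphi : atlas A phi := chart_at_atlas A x.
have dx : dom phi x := mem_chart_at A x.
pose y0 := phi x.
have : nbhs y0 (codom_chart phi).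
  by apply: open_nbhs_nbhs; split; [exact: codom_open|exact: codom_coord].
move=> /nbhs_ballP [e /= e0 ball_e].
(* Halving the radius places the closed cube of half-side [d] inside the open ball of radius [e]. *)
pose d := e / 2.
have d0 : 0 < d by rewrite divr_gt0.
pose Q : set 'rV[R]_4 := [set y | forall i, y 0 i \in `[y0 0 i - d, y0 0 i + d]].
have Qcodom : Q `<=` codom_chart phi.
  move=> y Qy; apply: ball_e; split=> // i j; rewrite ord1.
  have := Qy j; rewrite in_itv /= -ball_normE /= ltr_norml => /andP[h1 h2].
  by apply/andP; split; move: h1 h2 e0; rewrite /d; lra.
have cQ : compact Q.
  apply: (@rV_compact _ _ (fun i => `[y0 0 i - d, y0 0 i + d]%classic)) => i.
  exact: segment_compact.
pose K := coordV phi @` Q.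
have cK : closed K.
  apply: compact_closed => //; apply: continuous_compact cQ.
  apply: continuous_in_subspaceT => y /set_mem Qy.
  exact: coordV_continuous (Qcodom _ Qy).
pose b := cube_bump y0 d.
(* Dividing by the positive number [b y0] gives the field the value [v] at [x]. *)
exists (chart_vf phi b ((b y0)^-1 *: v)); split.
  apply: (@smooth_chart_vf phi b _ K) => //.
  - by move=> _ [y /Qcodom cy <-]; exact: dom_coordV.
  - move=> z dz nKz; have [i] : exists i, ~ phi z 0 i \in `[y0 0 i - d, y0 0 i + d].
      by apply/existsNP => Qz; apply: nKz; exists (phi z) => //; exact: coordK.
    move=> zi; apply: (@cube_bump_out _ _ _ _ _ i).
    rewrite leNgt ltr_norml; apply/negP => /andP[h1 h2]; apply: zi.
    by rewrite in_itv /=; apply/andP; split; move: h1 h2; lra.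
  - by move=> n; apply: Ck_cube_bump; exact: codom_open.
rewrite /chart_vf asboolT // transition_id // scalerA divff ?scale1r //.
by rewrite gt_eqF // cube_bump_center.
Qed.

Lemma smooth_extend (x : M) (v : 'rV[R]_4) : hausdorff_space M ->
  smooth_vf A (extend A x v) /\ extend A x v x = v.
Proof.
move=> hM; have [X HX] := exists_smooth_vf x v hM.
exact: (@xgetPex _ _ [set X | smooth_vf A X /\ X x = v] (ex_intro _ X HX)).
Qed.

Lemma smooth_fun_cst (a : R) : smooth_fun A (fun=> a).
Proof. by move=> phi _ n; exact: Ck_cst. Qed.

Lemma smooth_funD f h : smooth_fun A f -> smooth_fun A h ->
  smooth_fun A (fun x => f x + h x).
Proof. by move=> sf sh phi Aphi n; apply: CkD; [exact: codom_open|exact: sf|exact: sh]. Qed.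

Lemma smooth_funM f h : smooth_fun A f -> smooth_fun A h ->
  smooth_fun A (fun x => f x * h x).
Proof. by move=> sf sh phi Aphi n; apply: CkZ; [exact: codom_open|exact: sf|exact: sh]. Qed.

Lemma smooth_vf_scale f X : smooth_fun A f -> smooth_vf A X ->
  smooth_vf A (scale_vf f X).
Proof.
move=> sf sX phi Aphi n.
apply: (Ck_ext (g := fun y => (f (coordV phi y) : R^o) *: vf_in A phi X y)).
- exact: codom_open.
- by move=> y _; rewrite /vf_in /scale_vf linearZ.
- by apply: CkZ; [exact: codom_open|exact: sf|exact: sX].
Qed.

Lemma smooth_vfD X Y : smooth_vf A X -> smooth_vf A Y -> smooth_vf A (X \+ Y).
Proof.
move=> sX sY phi Aphi n.
apply: (Ck_ext (g := fun y => vf_in A phi X y + vf_in A phi Y y)).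
- exact: codom_open.
- by move=> y _; rewrite /vf_in /= linearD.
- by apply: CkD; [exact: codom_open|exact: sX|exact: sY].
Qed.

Lemma smooth_vfB X Y : smooth_vf A X -> smooth_vf A Y -> smooth_vf A (X \- Y).
Proof.
move=> sX sY; have -> : X \- Y = X \+ scale_vf (fun=> -1) Y.
  by apply/funext => x; rewrite /scale_vf /= scaleN1r.
by apply/smooth_vfD/smooth_vf_scale => //; exact: smooth_fun_cst.
Qed.

Lemma smooth_fun_continuous f : smooth_fun A f -> continuous (f : M -> R^o).
Proof.
move=> sf x; pose phi := chart_at A x.
have dx : dom phi x := mem_chart_at A x.
have cf := sf _ (chart_at_atlas A x) 0%N _ (codom_coord dx).
have : {for x, continuous ((fun y => f (coordV phi y) : R^o) \o phi)}.
  by apply: continuous_comp cf; exact: Defs.coord_continuous.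
rewrite /prop_for /continuous_at /= coordK // => h; apply: cvg_trans h.
apply: near_eq_cvg; apply: filterS (open_nbhs_nbhs (conj (@dom_open _ _ phi) dx)).
by move=> y dy; rewrite /= coordK.
Qed.

End Manifold.

(** The level set of [u] is closed, and for [u != v] it is open as the complement of the level set
    of [v]; if nonempty, it is all of [M]. *)
Lemma connected_two_values (R : realType) (M : topologicalType) (f : M -> R) u v :
  connected [set: M] -> continuous (f : M -> R^o) ->
  (forall x, f x = u \/ f x = v) -> f = (fun=> u) \/ f = (fun=> v).
Proof.
move=> cM cf fuv.
have [[x0 fx0]|nu] := pselect (exists x, f x = u); last first.
  by right; apply/funext => x; case: (fuv x) => // fx; case: nu; exists x.
have [uv|uv] := eqVneq u v.
  by left; apply/funext => x; case: (fuv x) => ->.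
left; suff fE : f @^-1` [set u] = setT.
  by apply/funext => x; rewrite -[_ = _]/((f @^-1` [set u]) x) fE.
apply: cM; first by exists x0.
- exists (f @^-1` (~` [set v])); last first.
    rewrite setTI; apply/seteqP; split=> x /=; first by move=> ->; exact/eqP.
    by case: (fuv x).
  apply: open_comp; first by move=> x _; exact: cf.
  by rewrite openC; exact: closed_eq.
- exists (f @^-1` [set u]); last by rewrite setTI.
  by apply: preimage_closed => //; exact: closed_eq.
Qed.

(** * The metric as a nondegenerate bilinear form on tangent spaces *)

Section Bilinear_form.
Context {R : realType} {M : topologicalType} {A : smooth_structure R M}.
Variable g : lorentz_metric A.

Definition gform (x : M) (u v : 'rV[R]_4) : R := (u *m gram g x *m v^T) 0 0.

Lemma gmetricE X Y x : gmetric g X Y x = gform x (X x) (Y x).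
Proof. by []. Qed.

Lemma gformC x u v : gform x u v = gform x v u.
Proof.
rewrite /gform -[in LHS](gram_sym g x) -[in LHS](trmxK u) -!trmx_mul mxE.
by rewrite mulmxA.
Qed.

Lemma gformDl x u1 u2 v : gform x (u1 + u2) v = gform x u1 v + gform x u2 v.
Proof. by rewrite /gform !mulmxDl mxE. Qed.

Lemma gformZl x a u v : gform x (a *: u) v = a * gform x u v.
Proof. by rewrite /gform -!scalemxAl mxE. Qed.

Lemma gformDr x u v1 v2 : gform x u (v1 + v2) = gform x u v1 + gform x u v2.
Proof. by rewrite gformC gformDl !(gformC x u). Qed.

Lemma gformZr x a u v : gform x u (a *: v) = a * gform x u v.
Proof. by rewrite gformC gformZl gformC. Qed.

Lemma gform0l x v : gform x 0 v = 0.
Proof. by rewrite -(scale0r 0) gformZl mul0r. Qed.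

Lemma gformNl x u v : gform x (- u) v = - gform x u v.
Proof. by rewrite -scaleN1r gformZl mulN1r. Qed.

Lemma gformNr x u v : gform x u (- v) = - gform x u v.
Proof. by rewrite -scaleN1r gformZr mulN1r. Qed.

Definition gformE := (gformDl, gformZl, gformNl, gformDr, gformZr, gformNr).

Lemma gform_delta x u j : gform x u (delta_mx 0 j) = (u *m gram g x) 0 j.
Proof. by rewrite /gform trmx_delta -colE mxE. Qed.

(** This is the trace of the rank-one endomorphism [w |-> g(w, v) u], the form in which traces of
    curvature expressions appear below. *)
Lemma gform_sum_delta x (u v : 'rV[R]_4) :
  \sum_i gform x (delta_mx 0 i) v * u 0 i = gform x u v.
Proof.
rewrite [in RHS](row_sum_delta u) /gform !mulmx_suml summxE.
apply: eq_bigr => i _; rewrite -!scalemxAl [RHS]mxE mulrC //.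
Qed.

Lemma gram_unit x : gram g x \in unitmx.
Proof.
have [P _ PG] := gram_signature g x.
have : @Defs.minkowski R \in unitmx.
  by rewrite unitmxE det_diag unitfE; apply/prodf_neq0 => i _; rewrite mxE;
    case: ifP => _; rewrite ?oppr_eq0 oner_eq0.
by rewrite -PG !unitmx_mul => /andP[/andP[]].
Qed.

End Bilinear_form.

Lemma vf_derivN (R : realType) (M : topologicalType) (A : smooth_structure R M)
    (X : M -> 'rV[R]_4) f x :
  smooth_fun A f -> vf_deriv A X (fun x => - f x) x = - vf_deriv A X f x.
Proof.
move=> sf; rewrite /vf_deriv.
have df : differentiable (fun z => f (coordV (chart_at A x) z) : R^o) (chart_at A x x).
  apply: Ck_differentiable (sf _ (chart_at_atlas A x) 1%N) _.
  exact/codom_coord/mem_chart_at.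
by have -> := diffN df.
Qed.

Lemma vf_deriv_cst (R : realType) (M : topologicalType) (A : smooth_structure R M)
    (X : M -> 'rV[R]_4) a x : vf_deriv A X (fun=> a) x = 0.
Proof. by rewrite /vf_deriv -/(cst (a : R^o)) diff_cst. Qed.

(** * Curvature of a torse-forming field *)

Section Torse_forming.
Context {R : realType} {M : topologicalType}.
Variables (A : smooth_structure R M) (g : lorentz_metric A)
  (nabla : (M -> 'rV[R]_4) -> (M -> 'rV[R]_4) -> M -> 'rV[R]_4)
  (xi : M -> 'rV[R]_4).
Hypotheses (hM : hausdorff_space M) (nablaP : levi_civita g nabla)
  (sxi : smooth_vf A xi) (xi_unit : forall x, gmetric g xi xi x = -1)
  (torse : torse_forming g nabla xi).

Local Notation eta := (dual_form g xi).
Local Notation sm := (smooth_vf A).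

Lemma gform_xi_xi x : gform g x (xi x) (xi x) = -1.
Proof. exact: xi_unit. Qed.

Lemma dual_formE X x : eta X x = gform g x (X x) (xi x).
Proof. by []. Qed.

Lemma smooth_dual_form X : sm X -> smooth_fun A (eta X).
Proof. by move=> sX; exact: gram_smooth. Qed.

Lemma torseE X x : sm X -> nabla X xi x = X x + eta X x *: xi x.
Proof. by move=> sX; rewrite torse. Qed.

Lemma bracketE X Y x : sm X -> sm Y ->
  bracket A X Y x = nabla X Y x - nabla Y X x.
Proof. by move=> sX sY; rewrite -(nabla_torsion_free nablaP). Qed.

Lemma smooth_bracket X Y : sm X -> sm Y -> sm (bracket A X Y).
Proof.
move=> sX sY; rewrite -(nabla_torsion_free nablaP) //.
by apply: smooth_vfB; exact: (nabla_smooth nablaP).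
Qed.

(** Apply [nabla X] to [Y + eta(Y) xi]; the derivative of [eta(Y) = g(Y, xi)] comes from metric
    compatibility and the torse-forming equation. *)
Lemma nabla_nabla_xi X Y x : sm X -> sm Y ->
  nabla X (nabla Y xi) x = nabla X Y x
    + (gform g x (nabla X Y x) (xi x) + gform g x (Y x) (X x)
       + eta X x * eta Y x) *: xi x
    + eta Y x *: (X x + eta X x *: xi x).
Proof.
move=> sX sY.
have sY' := smooth_dual_form sY.
rewrite torse // (nablaDr nablaP) //; last exact: smooth_vf_scale.
rewrite (nabla_leibniz nablaP) // (nabla_metric nablaP) // /scale_vf /=.
rewrite !torse // /scale_vf /= !gmetricE gformDr gformZr -!dual_formE.
by rewrite -!addrA.
Qed.

(** After antisymmetrization the terms symmetric in [X] and [Y] cancel, and vanishing torsion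
    absorbs [nabla X Y - nabla Y X] into the bracket term. *)
Lemma riemann_xi X Y x : sm X -> sm Y ->
  riemann A nabla X Y xi x = eta Y x *: X x - eta X x *: Y x.
Proof.
move=> sX sY.
rewrite /riemann /= !nabla_nabla_xi // torseE; last exact: smooth_bracket.
rewrite (dual_formE (bracket _ _ _)) bracketE // !gformE (gformC g x (Y x) (X x)).
by apply/rowP => i; rewrite !mxE; ring.
Qed.

(** The trace of [X |-> eta(Y) X - eta(X) Y] is [4 eta(Y) - eta(Y)]. *)
Lemma ricci_xi Y x : sm Y -> ricci A nabla Y xi x = 3 * eta Y x.
Proof.
move=> sY; rewrite /ricci /trace_vf /mxtrace.
transitivity (\sum_i (eta Y x - gform g x (delta_mx 0 i) (xi x) * Y x 0 i)).
  apply: eq_bigr => i _; have [sE Ex] := smooth_extend A x (delta_mx 0 i) hM.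
  by rewrite mxE riemann_xi // (dual_formE (extend _ _ _)) Ex !mxE !eqxx /= mulr1.
rewrite big_split /= sumrN gform_sum_delta sumr_const card_ord -mulr_natl.
by rewrite dual_formE; ring.
Qed.

(** Differentiate [g(V, xi) = 0] along [Z] and insert [nabla Z xi = Z + eta(Z) xi]. *)
Lemma dual_nabla_orthogonal V Z x : sm V -> sm Z -> (forall x, eta V x = 0) ->
  eta (nabla Z V) x = - gmetric g V Z x.
Proof.
move=> sV sZ V0.
have : vf_deriv A Z (eta V) x = 0.
  have -> : eta V = fun=> 0 by exact/funext.
  exact: vf_deriv_cst.
rewrite (nabla_metric nablaP) // torse // => /eqP.
rewrite /= !gmetricE /scale_vf /= !gformE -!dual_formE V0 mulr0 addr0 addr_eq0.
by move=> /eqP.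
Qed.

(* As eta V vanishes identically, metric compatibility alone suffices: the
   symmetry of second derivatives, i.e. XYf - YXf = [X,Y]f, is not required. *)
Lemma dual_riemann_orthogonal V Y Z x : sm V -> sm Y -> sm Z ->
  (forall x, eta V x = 0) ->
  eta (riemann A nabla Y Z V) x =
    eta Y x * gmetric g V Z x - eta Z x * gmetric g V Y x.
Proof.
move=> sV sY sZ V0.
(* Differentiating [eta(nabla W V) = - g(V, W)] along [X] computes the second derivatives of [V]
   paired with [xi]. *)
have key X W : sm X -> sm W ->
    eta (nabla X (nabla W V)) x =
    - gform g x (nabla X V x) (W x) - gform g x (V x) (nabla X W x)
    - gform g x (nabla W V x) (X x) + eta X x * gform g x (V x) (W x).
  move=> sX sW; have sWV : sm (nabla W V) by exact: (nabla_smooth nablaP).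
  have : vf_deriv A X (eta (nabla W V)) x = - vf_deriv A X (gmetric g V W) x.
    have -> : eta (nabla W V) = fun x => - gmetric g V W x.
      by apply/funext => y; exact: dual_nabla_orthogonal.
    by apply: vf_derivN; exact: gram_smooth.
  rewrite !(nabla_metric nablaP) // torse // /= !gmetricE /scale_vf /= !gformE.
  rewrite -!dual_formE (dual_nabla_orthogonal _ sV sW V0) gmetricE => h.
  by move: h; lra.
rewrite dual_formE /riemann /= !gformE -!dual_formE !key //.
rewrite (dual_nabla_orthogonal _ sV (smooth_bracket sY sZ) V0).
rewrite !gmetricE bracketE // !gformE.
rewrite !(gformC g x (nabla _ V x)); ring.
Qed.

End Torse_forming.

(** * Perfect fluids *)

Section Perfect_fluid.
Context {R : realType} {M : topologicalType}.
Variables (A : smooth_structure R M) (g : lorentz_metric A)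
  (nabla : (M -> 'rV[R]_4) -> (M -> 'rV[R]_4) -> M -> 'rV[R]_4)
  (xi : M -> 'rV[R]_4).
Hypotheses (hM : hausdorff_space M) (nablaP : levi_civita g nabla)
  (sxi : smooth_vf A xi) (xi_unit : forall x, gmetric g xi xi x = -1)
  (torse : torse_forming g nabla xi).
Variables (lam k : R) (p sigma : M -> R).
Hypotheses (p_smooth : smooth_fun A p)
  (fluid : perfect_fluid g nabla lam k p sigma xi).

Local Notation eta := (dual_form g xi).
Local Notation sm := (smooth_vf A).
Local Notation r := (scalar_curvature g nabla).

Let eta_xi x : eta xi x = -1. Proof. exact: xi_unit. Qed.

Let ricci_eta Y x : sm Y -> ricci A nabla Y xi x = 3 * eta Y x.
Proof. by move=> sY; exact: (ricci_xi hM nablaP). Qed.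

Let smooth_extend_delta x i := smooth_extend A x (delta_mx 0 i : 'rV[R]_4) hM.

Lemma fluid_ricci_op X x : sm X -> ricci_op g nabla X x =
  - (lam - r x / 2 - k * p x) *: X x + (k * (sigma x + p x) * eta X x) *: xi x.
Proof.
move=> sX; rewrite /ricci_op.
set a := - _; set b := k * (sigma x + p x).
(* [ricci_op] ends with the inverse Gram matrix; writing the right side [w] as [w *m G *m invmx G]
   leaves the comparison of [S(X, e_j)] with [g(w, e_j)]. *)
rewrite -[RHS](mulmxK (gram_unit g x)); congr (_ *m _).
apply/rowP => j; have [sE Ex] := smooth_extend_delta x j.
rewrite [LHS]mxE fluid // -/a -/b gmetricE (dual_formE g xi (extend _ _ _)) Ex.
rewrite (gformC g x _ (xi x)) !gform_delta.
by rewrite [in RHS]mulmxDl -!scalemxAl [in RHS]mxE; congr (_ + _); rewrite [RHS]mxE.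
Qed.

(** The identity has trace 4 and [X |-> eta(X) xi] has trace [g(xi, xi) = -1]. *)
Lemma fluid_scalar_curvature x :
  r x = - 4 * (lam - r x / 2 - k * p x) - k * (sigma x + p x).
Proof.
rewrite {1}/scalar_curvature /trace_vf /mxtrace.
set a := lam - r x / 2 - k * p x; set b := k * (sigma x + p x).
transitivity (\sum_i (- a + b * (gform g x (delta_mx 0 i) (xi x) * xi x 0 i))).
  apply: eq_bigr => i _; have [sE Ex] := smooth_extend_delta x i.
  rewrite mxE fluid_ricci_op // -/a -/b (dual_formE g xi (extend _ _ _)) Ex.
  by rewrite !mxE !eqxx /= mulr1 mulrA.
rewrite big_split /= -mulr_sumr gform_sum_delta gform_xi_xi //.
by rewrite sumr_const card_ord -mulr_natl; ring.
Qed.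

(** [S(xi, xi)] equals -3 by [ricci_xi]; equating this with the fluid expression and using the trace
    identity eliminates [r]. *)
Lemma fluid_density x : k * sigma x = 2 * lam - 3 * (k * p x) - 6.
Proof.
have := fluid sxi sxi x; rewrite ricci_eta // gmetricE gform_xi_xi // eta_xi.
by have := fluid_scalar_curvature x; lra.
Qed.

(** The coefficient of [g] in [S] once [r] and [sigma] are eliminated. Since
    [ricci_coef x + 3 = 2 (lam - k p)], its value -3 corresponds to [p = lam / k]. *)
Definition ricci_coef x : R := 2 * lam - 3 - 2 * (k * p x).

Lemma fluid_scalar_curvatureE x : r x = 3 * ricci_coef x + 3.
Proof.
by rewrite /ricci_coef; have := fluid_scalar_curvature x; have := fluid_density x; lra.
Qed.

Lemma fluid_coefs x :
  - (lam - r x / 2 - k * p x) = ricci_coef x /\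
  k * (sigma x + p x) = ricci_coef x - 3.
Proof.
rewrite fluid_scalar_curvatureE /ricci_coef; have := fluid_density x.
by move=> h; split; move: h; lra.
Qed.

Lemma fluid_ricciE X Y x : sm X -> sm Y ->
  ricci A nabla X Y x =
  ricci_coef x * gmetric g X Y x + (ricci_coef x - 3) * (eta X x * eta Y x).
Proof.
by move=> sX sY; rewrite fluid //; have [-> ->] := fluid_coefs x; rewrite mulrA.
Qed.

Lemma fluid_ricci_opE X x : sm X -> ricci_op g nabla X x =
  ricci_coef x *: X x + ((ricci_coef x - 3) * eta X x) *: xi x.
Proof. by move=> sX; rewrite fluid_ricci_op //; have [-> ->] := fluid_coefs x. Qed.

Lemma smooth_ricci_coef : smooth_fun A ricci_coef.
Proof.
have -> : ricci_coef = fun x => (2 * lam - 3) + (- 2 * k) * p x.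
  by apply/funext => x; rewrite /ricci_coef; ring.
apply: smooth_funD; first exact: smooth_fun_cst.
by apply: smooth_funM => //; exact: smooth_fun_cst.
Qed.

(** [ricci] is defined through extensions chosen separately at each point, so smoothness is read off
    the closed form [fluid_ricciE]. *)
Lemma smooth_ricci X Y : sm X -> sm Y -> smooth_fun A (ricci A nabla X Y).
Proof.
move=> sX sY.
have -> : ricci A nabla X Y = fun x => ricci_coef x * gmetric g X Y x +
    (ricci_coef x + -3) * (eta X x * eta Y x).
  by apply/funext => x; exact: fluid_ricciE.
have sc := smooth_ricci_coef.
apply: smooth_funD; apply: smooth_funM => //.
- exact: gram_smooth.
- by apply: smooth_funD => //; exact: smooth_fun_cst.
- by apply: smooth_funM; exact: smooth_dual_form.
Qed.

Lemma smooth_wedge_ricci X Y Z : sm X -> sm Y -> sm Z ->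
  sm (wedge_ricci A nabla X Y Z).
Proof.
by move=> sX sY sZ; apply: smooth_vfB; apply: smooth_vf_scale => //; exact: smooth_ricci.
Qed.

(** The projections [E + eta(E) xi] are orthogonal to [xi] at every point, as differentiating
    [eta(V) = 0] requires. One that is nonzero at [x] pairs nontrivially with some basis vector by
    nondegeneracy. *)
Lemma exists_orthogonal x : exists X Y,
  [/\ sm X, sm Y, forall y, eta X y = 0 & gmetric g X Y x != 0].
Proof.
pose h i := extend A x (delta_mx 0 i) \+
  scale_vf (eta (extend A x (delta_mx 0 i))) xi.
have sh i : sm (h i).
  have [sE _] := smooth_extend_delta x i.
  by apply/smooth_vfD/smooth_vf_scale => //; exact: smooth_dual_form.
have h0 i y : eta (h i) y = 0.
  rewrite dual_formE /h /scale_vf /= !gformE gform_xi_xi // -dual_formE; ring.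
(* u |-> u + eta(u) xi has trace 3, hence does not kill every basis vector. *)
have [i hi] : exists i, h i x != 0.
  apply: contrapT => /forallNP H.
  have : \sum_i h i x 0 i = 3.
    transitivity (\sum_i (1 + gform g x (delta_mx 0 i) (xi x) * xi x 0 i)).
      apply: eq_bigr => i _; have [_ Ex] := smooth_extend_delta x i.
      by rewrite /h /scale_vf /= (dual_formE g xi (extend _ _ _)) Ex !mxE !eqxx.
    rewrite big_split /= gform_sum_delta gform_xi_xi // sumr_const card_ord; lra.
  rewrite big1; first by lra.
  by move=> i _; have /negP := H i; rewrite negbK => /eqP ->; rewrite mxE.
have hG : h i x *m gram g x != 0.
  apply: contra_neq hi => hG; rewrite -(mulmxK (gram_unit g x) (h i x)) hG.
  by rewrite mul0mx.
have [j hj] : exists j, (h i x *m gram g x) 0 j != 0.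
  by apply/rV0Pn.
have [sE Ex] := smooth_extend_delta x j.
by exists (h i), (extend A x (delta_mx 0 j)); split; rewrite // gmetricE Ex gform_delta.
Qed.

(** Pair the condition at [(X, Y, xi, xi)] with [xi]. The two middle terms vanish because [T(Z,W)xi]
    is orthogonal to [xi]; the outer ones give [c * ricci_coef * g(X,Y)] and [3 * c * g(X,Y)], the
    latter since the wedge sends [xi] to [3 X]. *)
Lemma wedge_annihilates_coef T c : smooth_fun A c ->
  (forall Y Z, sm Y -> sm Z ->
    T Y Z xi = fun x => c x *: (eta Z x *: Y x - eta Y x *: Z x)) ->
  (forall Y V x, sm Y -> sm V -> (forall y, eta V y = 0) ->
    eta (T Y xi V) x = c x * gmetric g V Y x) ->
  ricci_wedge_annihilates A nabla xi T ->
  forall x, c x * (ricci_coef x + 3) = 0.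
Proof.
move=> sc Txi Tperp TA x.
have [X [Y [sX sY X0 XY]]] := exists_orthogonal x.
have sw Z : sm Z -> sm (wedge_ricci A nabla xi X Z).
  by move=> sZ; exact: smooth_wedge_ricci.
have sT : sm (T Y xi xi).
  rewrite Txi //; apply: smooth_vf_scale => //.
  by apply: smooth_vfB; apply: smooth_vf_scale => //; exact: smooth_dual_form.
have w0 y : eta (wedge_ricci A nabla xi X xi) y = 0.
  rewrite dual_formE /wedge_ricci /scale_vf /= ricci_eta // !gformE.
  by rewrite -!dual_formE X0; ring.
have e1 : eta (wedge_ricci A nabla xi X (T Y xi xi)) x =
    c x * ricci_coef x * gmetric g X Y x.
  rewrite dual_formE /wedge_ricci /scale_vf /= !gformE.
  rewrite -!dual_formE X0 mulr0 subr0 eta_xi fluid_ricciE // X0 gmetricE Txi //.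
  by rewrite !gformE -!(dual_formE g xi) X0 eta_xi gmetricE; ring.
have Txi0 Z W : sm Z -> sm W -> eta (T Z W xi) x = 0.
  move=> sZ sW; rewrite dual_formE Txi // !gformE -!(dual_formE g xi); ring.
have e4 : eta (T Y xi (wedge_ricci A nabla xi X xi)) x = 3 * c x * gmetric g X Y x.
  rewrite Tperp //; last exact: sw.
  rewrite !gmetricE /wedge_ricci /scale_vf /= !gformE !ricci_eta //.
  by rewrite X0 eta_xi; ring.
have := congr1 (fun u => gform g x u (xi x)) (TA X Y xi xi sX sY sxi sxi x).
rewrite 3!gformDl gform0l -!(dual_formE g xi) e1 e4.
rewrite (Txi0 _ _ (sw _ sY) sxi) (Txi0 _ _ sY (sw _ sxi)) => h.
by apply: (mulIf XY); rewrite mul0r -[RHS]h; ring.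
Qed.

Let riemannxi Y Z x : sm Y -> sm Z ->
  riemann A nabla Y Z xi x = eta Z x *: Y x - eta Y x *: Z x.
Proof. by move=> sY sZ; exact: (riemann_xi nablaP). Qed.

Let riemann_orthogonal Y V x : sm Y -> sm V -> (forall y, eta V y = 0) ->
  gform g x (riemann A nabla Y xi V x) (xi x) = gmetric g V Y x.
Proof.
move=> sY sV V0; rewrite -(dual_formE g xi) (dual_riemann_orthogonal nablaP) //.
by rewrite eta_xi -/(eta V x) V0; ring.
Qed.

Lemma riemann_annihilates_coef :
  ricci_wedge_annihilates A nabla xi (riemann A nabla) ->
  forall x, ricci_coef x + 3 = 0.
Proof.
move=> RA x; rewrite -[LHS]mul1r.
apply: (wedge_annihilates_coef (c := fun=> 1) _ _ _ RA).
- exact: smooth_fun_cst.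
- by move=> Y Z sY sZ; apply/funext => y; rewrite riemannxi // scale1r.
- by move=> Y V y sY sV V0; rewrite dual_formE riemann_orthogonal // mul1r.
Qed.

(** Here [c = 1 - r / 12] with [r = 3 * ricci_coef + 3]. *)
Lemma concircular_annihilates_coef :
  ricci_wedge_annihilates A nabla xi (concircular g nabla) ->
  forall x, (3 - ricci_coef x) * (ricci_coef x + 3) = 0.
Proof.
move=> PA x.
have : (3 / 4 + - 4^-1 * ricci_coef x) * (ricci_coef x + 3) = 0; last by lra.
apply: (wedge_annihilates_coef (c := fun x => 3 / 4 + - 4^-1 * ricci_coef x) _ _ _ PA).
- apply: smooth_funD; first exact: smooth_fun_cst.
  by apply: smooth_funM; [exact: smooth_fun_cst|exact: smooth_ricci_coef].
- move=> Y Z sY sZ; apply/funext => y; rewrite /concircular riemannxi //.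
  rewrite fluid_scalar_curvatureE (gmetricE g xi Y) gformC -(dual_formE g xi).
  rewrite -/(eta Z y); apply/rowP => i; rewrite !mxE; by field.
- move=> Y V y sY sV V0; rewrite dual_formE /concircular gformDl riemann_orthogonal // !gformE.
  rewrite -!(dual_formE g xi) eta_xi fluid_scalar_curvatureE.
  rewrite (gmetricE g xi V) gformC -(dual_formE g xi) V0; by field.
Qed.

(** Here [c = 1 - (ricci_coef + 3) / 2]: in [T(Y,Z)xi] the Ricci operator contributes [ricci_coef],
    the Ricci tensor contributes 3, and the multiples of [xi] in [QY] and [QZ] cancel. *)
Lemma conharmonic_annihilates_coef :
  ricci_wedge_annihilates A nabla xi (conharmonic g nabla) ->
  forall x, (ricci_coef x + 1) * (ricci_coef x + 3) = 0.
Proof.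
move=> HA x.
have : (- 2^-1 + - 2^-1 * ricci_coef x) * (ricci_coef x + 3) = 0; last by lra.
apply: (wedge_annihilates_coef (c := fun x => - 2^-1 + - 2^-1 * ricci_coef x) _ _ _ HA).
- apply: smooth_funD; first exact: smooth_fun_cst.
  by apply: smooth_funM; [exact: smooth_fun_cst|exact: smooth_ricci_coef].
- move=> Y Z sY sZ; apply/funext => y; rewrite /conharmonic riemannxi //.
  rewrite !fluid_ricci_opE // !fluid_ricciE //.
  rewrite !(gmetricE g xi _) !(gformC g y (xi y)) -!(dual_formE g xi).
  rewrite -/(eta Z y) eta_xi; apply/rowP => i; rewrite !mxE; by field.
- move=> Y V y sY sV V0; rewrite dual_formE /conharmonic gformDl riemann_orthogonal //.
  rewrite !fluid_ricci_opE // !fluid_ricciE // !gformE.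
  rewrite !(gmetricE g xi V) (gformC g y (xi y) (V y)) -!(dual_formE g xi) V0 eta_xi.
  by field.
Qed.

End Perfect_fluid.

(** * From pointwise alternatives to equalities of functions *)

Unset Implicit Arguments.

Theorem theorem3p2 (R : realType) (M : topologicalType)
  (M_hausdorff : hausdorff_space M) (M_countable : @second_countable M)
  (M_connected : connected [set: M])
  (A : smooth_structure R M) (g : lorentz_metric A)
  (nabla : (M -> 'rV[R]_4) -> (M -> 'rV[R]_4) -> M -> 'rV[R]_4)
  (nablaP : levi_civita g nabla)
  (lam k : R) (k_gt0 : 0 < k)
  (p sigma : M -> R) (p_smooth : smooth_fun A p)
  (sigma_smooth : smooth_fun A sigma)
  (xi : M -> 'rV[R]_4) (xi_smooth : smooth_vf A xi)
  (xi_unit : forall x, gmetric g xi xi x = -1)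
  (fluid : perfect_fluid g nabla lam k p sigma xi)
  (torse : torse_forming g nabla xi) :
  [/\ ricci_wedge_annihilates A nabla xi (riemann A nabla) ->
        p = (fun=> lam / k),
      ricci_wedge_annihilates A nabla xi (concircular g nabla) ->
        p = (fun=> lam / k) \/
        p = (fun x => (4 * lam + k * sigma x - 12) / (3 * k)),
      ricci_wedge_annihilates A nabla xi (conformal g nabla) ->
        p = (fun=> lam / k) \/
        p = (fun x => (2 * lam - k * sigma x - 6) / (3 * k)) &
      ricci_wedge_annihilates A nabla xi (conharmonic g nabla) ->
        p = (fun=> lam / k) \/ p = (fun=> (lam - 1) / k)].
Proof.
have kn0 : k != 0 by rewrite gt_eqF.
have cp := smooth_fun_continuous p_smooth.
have density := fluid_density M_hausdorff nablaP xi_smooth xi_unit torse fluid.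
have p_lam x : ricci_coef lam k p x + 3 = 0 -> p x = lam / k.
  by rewrite /ricci_coef => h; apply: (mulfI kn0); rewrite mulrCA divff ?mulr1 //; lra.
split.
- move=> RA; apply/funext => x; apply: p_lam.
  exact: (riemann_annihilates_coef M_hausdorff nablaP xi_smooth xi_unit torse p_smooth fluid RA).
- move=> PA.
  have H := concircular_annihilates_coef M_hausdorff nablaP xi_smooth xi_unit
    torse p_smooth fluid PA.
  (* The root [ricci_coef = 3] means [p = (lam - 3) / k]. This constant lets connectedness apply
     before [density] turns it into the stated expression in [sigma]. *)
  have [x|->|pE] := @connected_two_values R M p (lam / k) ((lam - 3) / k) M_connected cp.
  + have /eqP := H x; rewrite mulf_eq0 => /orP[|] /eqP h; last by left; exact: p_lam.
    right; apply: (mulfI kn0); rewrite mulrCA divff // mulr1.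
    by move: h; rewrite /ricci_coef; lra.
  + by left.
  + right; apply/funext => x; have := density x.
    have -> : k * p x = lam - 3 by rewrite pE mulrCA divff ?mulr1.
    by rewrite pE => ->; field.
- move=> _; right; apply/funext => x; rewrite density.
  by field.
- move=> HA.
  have H := conharmonic_annihilates_coef M_hausdorff nablaP xi_smooth xi_unit
    torse p_smooth fluid HA.
  (* The root [ricci_coef = -1] means [p = (lam - 1) / k]. *)
  apply: connected_two_values => // x.
  have /eqP := H x; rewrite mulf_eq0 => /orP[|] /eqP h; last by left; exact: p_lam.
  right; apply: (mulfI kn0); rewrite mulrCA divff // mulr1.
  by move: h; rewrite /ricci_coef; lra.
Qed.
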